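(* Let $k\geq 1$ be an integer, let $\mu_1,\dots,\mu_{2k}$ be absolutely continuous probability measures in $\mathbb{R}^2$ with compact support, and let $\alpha_1,\dots,\alpha_{2k}$ be positive real numbers with $\alpha_1+\dots+\alpha_{2k}=1$. Then there is a partition of the plane into $2k$ convex regions $Q_1,\dots,Q_{2k}$ using $k$ lines, such that $Q_1,\dots,Q_{2k}$ are ordered in a counterclockwise order, and there is a permutation $\pi:[2k]\to[2k]$ such that $\mu_{\pi(i)}(Q_i)\geq\alpha_i$ for all $i\in[2k]$.
   Context: Here $[m]=\{1,2,\dots,m\}$, and absolute continuity is with respect to the Lebesgue measure on $\mathbb{R}^2$. A partition of the plane into convex regions $Q_1,\dots,Q_{2k}$ means closed convex sets whose union is $\mathbb{R}^2$ and whose interiors are pairwise disjoint. The partition uses $k$ lines if there are $k$ lines in the plane whose union contains the boundaries of all the regions $Q_i$ (a region is not required to be a single cell of the arrangement of these lines). The regions $Q_1,\dots,Q_{2k}$ are ordered in a counterclockwise order if there is a circle $S\subset\mathbb{R}^2$ and points $z_0,z_1,\dots,z_{2k}=z_0$ appearing in this counterclockwise order on $S$ such that, for each $i\in[2k]$, $Q_i\cap S$ is the closed counterclockwise arc of $S$ from $z_{i-1}$ to $z_i$. *)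

(* Defs.v *)
From HB Require Import structures.
From mathcomp Require Import all_boot all_order all_algebra.
From mathcomp Require Import perm.
From mathcomp Require Import all_classical all_reals all_analysis.

Set Implicit Arguments.
Unset Strict Implicit.
Unset Printing Implicit Defensive.
Import Order.TTheory GRing.Theory Num.Theory.
Import numFieldNormedType.Exports.
Local Open Scope classical_set_scope.
Local Open Scope ring_scope.

(* The plane is R * R. Its sigma-algebra is the product of two copies of the  *)
(* Borel sigma-algebra measurableTypeR R, whose carrier is convertible to R,  *)
(* so that a set (R * R) can be measured directly.                            *)

Definition plane_lebesgue (R : realType) :
    {measure set (measurableTypeR R * measurableTypeR R) -> \bar R} :=
  (@lebesgue_measure R \x @lebesgue_measure R)%E.

Definition measure_support (R : realType)
    (mu : {measure set (measurableTypeR R * measurableTypeR R) -> \bar R}) :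
    set (R * R) :=
  [set p | forall U : set (R * R), open U -> U p -> (0 < mu U)%E].

Definition is_line (R : realType) (L : set (R * R)) : Prop :=
  exists a b c : R, (a, b) <> (0, 0) /\
    L = [set p | a * p.1 + b * p.2 = c].

Definition boundary (T : topologicalType) (A : set T) : set T :=
  closure A `\` A°.

Definition convex_partition (R : realType) (n : nat)
    (Q : 'I_n -> set (R * R)) : Prop :=
  [/\ forall i, closed (Q i),
      forall i, convex_set (Q i),
      \bigcup_i Q i = setT &
      trivIset setT (fun i => (Q i)°)].

Definition uses_lines (R : realType) (k n : nat)
    (Q : 'I_n -> set (R * R)) : Prop :=
  exists L : 'I_k -> set (R * R),
    [/\ injective L,
        forall j, is_line (L j) &
        forall i, boundary (Q i) `<=` \bigcup_j L j].

Definition circle (R : realType) (c : R * R) (r : R) : set (R * R) :=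
  [set p | (p.1 - c.1) ^+ 2 + (p.2 - c.2) ^+ 2 = r ^+ 2].

Definition circle_point (R : realType) (c : R * R) (r t : R) : R * R :=
  (c.1 + r * cos t, c.2 + r * sin t).

(* The points z_0, ..., z_n = z_0 in counterclockwise order on the circle are *)
(* z_i = circle_point c r (theta i), for angles increasing over exactly one   *)
(* turn. Regions are indexed from 0: Q i corresponds to the arc from z_i to   *)
(* z_(i+1).                                                                   *)
Definition counterclockwise_order (R : realType) (n : nat)
    (Q : 'I_n -> set (R * R)) : Prop :=
  exists (c : R * R) (r : R) (theta : nat -> R),
    [/\ 0 < r,
        forall i : 'I_n, theta i < theta i.+1,
        theta n = theta 0%N + 2 * pi &
        forall i : 'I_n,
          Q i `&` circle c r = circle_point c r @` `[theta i, theta i.+1]].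

(* Main.v *)
(* Kuhn's cubical labelling lemma, with the vertices of the triangulation      *)
(* distributed among the measures, gives a colorful KKM theorem on the cube    *)
(* [0, 1]^(2k-1). A point y of the cube is read as angles theta_m, 2 pi times  *)
(* the running maxima of y, cutting a large circle into 2k arcs. The k chords  *)
(* joining opposite division points (theta_m, theta_(m+k)) span k lines: the   *)
(* first one halves the plane, and each half is then cut successively by the   *)
(* other lines, one convex piece being split off at each step. The i-th region *)
(* meets the circle in the i-th arc, and is null when that arc is degenerate,  *)
(* a line through two points of the circle being allowed to become a tangent.  *)
(* The sets of all y such that mu_j (Q_i y) >= alpha_i are closed, cover the   *)
(* cube for each j, and satisfy the boundary conditions of the KKM theorem.    *)

Require Import Defs.
From mathcomp Require Import all_boot all_order all_algebra.
From mathcomp Require Import fingroup perm.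
From mathcomp Require Import all_classical all_reals all_analysis.
From mathcomp Require Import measurable_realfun zify ring lra.
Import Order.TTheory GRing.Theory Num.Theory.
Import numFieldNormedType.Exports.

Set Implicit Arguments.
Unset Strict Implicit.
Unset Printing Implicit Defensive.

(** * Kuhn's cubical labelling lemma *)

(** Once the division points on the circle are chosen, convexity, the k lines and the cyclic order
    come from [regions_partition], provided no arc is degenerate. What remains is a fair division
    problem: measure j accepts region i when its mass there is at least [alpha i], and distinct
    measures are to be assigned to the regions. For every choice of arcs each measure accepts some
    region, because the regions cover the plane and the thresholds add up to 1. Acceptance is a
    closed condition ([region_measure_closed]) and fails for a region with a degenerate arc, which
    is null ([region_null]). These facts are the hypotheses of [colorful_kkm]. In its proof each
    vertex of a fine triangulation is labelled by a region that its owner accepts; a simplex with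
    all labels, found by a parity count of facets ([kuhn_labelling]), is an approximate solution,
    and compactness turns it into an exact one. At the solution every region has positive mass for
    its measure, so no arc was degenerate after all. *)

Lemma odd_card_involution (T : finType) (P : {set T}) (f : T -> T) :
  {in P, forall x, f x \in P} -> {in P, forall x, f (f x) = x} ->
  odd #|P| = odd #|[set x in P | f x == x]|.
Proof.
have [n] := ubnP #|P|; elim: n => // n IHn in P *; rewrite ltnS => leP fP ffP.
have [/exists_inP[x xP fx]|/exists_inPn nofix] :=
    boolP [exists (x | x \in P), f x != x]; last first.
  congr (odd #|pred_of_set _|); apply/setP => x; rewrite inE.
  by have [xP /=|//] := boolP (x \in P); have := nofix x xP; rewrite negbK.
have fxP : f x \in P :\ x by rewrite !inE fx fP.
have cP : #|P| = (#|P :\ x :\ f x|).+2.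
  by rewrite (cardsD1 x) xP (cardsD1 (f x)) fxP.
have P'P y : (y \in P :\ x :\ f x) = [&& y != f x, y != x & y \in P].
  by rewrite !inE.
rewrite cP /= negbK IHn.
- congr (odd #|pred_of_set _|); apply/setP => y; rewrite !inE.
  have [->|_] := eqVneq y (f x).
    by rewrite (ffP x xP) (_ : (x == f x) = false) ?andbF // eq_sym (negbTE fx).
  by have [->|] := eqVneq y x; rewrite //= (negbTE fx) andbF.
- by move: leP; rewrite cP => /ltnW.
- move=> y; rewrite !P'P => /and3P[yfx yx yP]; rewrite fP // andbT.
  apply/andP; split; first by apply: contra_neq yx => e; rewrite -(ffP _ yP) e ffP.
  by apply: contra_neq yfx => <-; rewrite ffP.
- by move=> y; rewrite P'P => /and3P[_ _]; apply: ffP.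
Qed.

Section Facets.
Variables (n : nat) (lam : 'I_n.+1 -> 'I_n.+1).

(* The facet opposite to the vertex [j] carries all the labels but the last. *)
Definition full_facet (j : 'I_n.+1) : bool :=
  [forall l, (l != ord_max) ==> [exists i, (i != j) && (lam i == l)]].

Lemma full_facetP j :
  reflect (forall l, l != ord_max -> exists2 i, i != j & lam i = l) (full_facet j).
Proof.
apply: (iffP forallP) => H l.
  by move=> lm; have /implyP/(_ lm)/existsP[i /andP[ij /eqP]] := H l; exists i.
by apply/implyP => /H[i ij il]; apply/existsP; exists i; rewrite ij il eqxx.
Qed.

(** The facet has n vertices and carries n prescribed labels, so no label can be repeated. *)
Lemma full_facet_inj j : full_facet j -> {in [set~ j] &, injective lam}.
Proof.
move=> /full_facetP H; apply/imset_injP; rewrite eqn_leq leq_imset_card.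
have -> : #|[set~ j]| = #|[set~ (@ord_max n)]| by rewrite !cardsC1.
apply/subset_leq_card/fintype.subsetP => l; rewrite !inE => /H[i ij <-].
by apply: imset_f; rewrite !inE.
Qed.

(** If the facet opposite [j] is full, non-injectivity makes the label of [j] repeat that of a
    unique vertex [j'] of the facet. Exchanging [j] and [j'] gives the only other full facet:
    omitting any third vertex would keep the repeated label. *)
Lemma even_full_facets : ~ injective lam -> ~~ odd #|[set j | full_facet j]|.
Proof.
move=> ninj; have [->|[j]] := set_0Vmem [set j | full_facet j]; first by rewrite cards0.
rewrite inE => Fj; have injj := full_facet_inj Fj.
have [j' j'j e] : exists2 j', j' != j & lam j' = lam j.
  move/full_facetP: (Fj); apply; apply/eqP => lj; apply: ninj => a b.
  have H c : lam c = ord_max -> c = j.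
    move=> lc; apply/eqP/negPn/negP => cj.
    have : #|lam @: [set~ j]| = n by rewrite card_in_imset // cardsC1 card_ord.
    suff -> : lam @: [set~ j] = [set: 'I_n.+1] by rewrite cardsT card_ord => /esym/n_Sn.
    apply/setP => l; rewrite [RHS]inE; have [->|lm] := eqVneq l ord_max.
      by rewrite -lc imset_f // !inE.
    by have [i ij <-] := full_facetP _ Fj l lm; rewrite imset_f // !inE.
  have [->|aj] := eqVneq a j; have [->//|bj] := eqVneq b j.
  - by move=> ab; rewrite (H b) // -ab lj.
  - by move=> ab; rewrite (H a) // ab lj.
  - by move=> ab; apply: injj; rewrite ?inE.
suff -> : [set j | full_facet j] = [set j; j'] by rewrite cards2 eq_sym j'j.
apply/setP => i; rewrite !inE; apply/idP/idP => [Fi|/orP[]/eqP->//].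
  apply/negPn/negP; rewrite negb_or => /andP[ij ij']; move/eqP: j'j; apply.
  by apply: (full_facet_inj Fi); rewrite ?inE // eq_sym.
apply/full_facetP => l /(full_facetP _ Fj)[a aj <-].
have [->|aj'] := eqVneq a j'; first by exists j; rewrite // eq_sym.
by exists a.
Qed.

End Facets.

Section KuhnTriangulation.
Variable d : nat.
Implicit Types (tau : {perm 'I_d.+1}).

(* Vertices of the simplex with least vertex [v]: going from one vertex to the *)
(* next, a single coordinate is incremented, [tau i] giving the step at which  *)
(* this happens to [i].                                                        *)
Definition kuhn_vertex (v : 'I_d.+1 -> nat) tau (j : nat) : {ffun 'I_d.+1 -> nat} :=
  [ffun i => v i + (tau i < j)].

Variable m : nat.
Local Notation base := {ffun 'I_d.+1 -> 'I_m.+1}.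
Local Notation flag := (base * {perm 'I_d.+1} * 'I_d.+2)%type.

(** A flag is a simplex with a marked vertex and stands for the facet opposite to it; the vertices
    do not depend on the mark. *)
Definition flag_vertex (x : flag) (j : 'I_d.+2) : {ffun 'I_d.+1 -> nat} :=
  kuhn_vertex (fun i => x.1.1 i) x.1.2 j.

Definition ffun_upd (v : base) i (c : nat) : base :=
  [ffun i' => if i' == i then inord c else v i'].

(* Passes to the simplex on the other side of the facet opposite to the vertex *)
(* with index [x.2]; the fixed points are the facets on the boundary that have *)
(* constant value [m.+1] or [0] in some coordinate.                            *)
Definition flip (x : flag) : flag :=
  let: (v, tau, j) := x in
  if j == ord0 then
    let i := (tau^-1)%g ord0 in
    if v i == m :> nat then x
    else (ffun_upd v i (v i).+1, (tau * perm (@ord_pred_inj d.+1))%g, ord_max)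
  else if j == ord_max then
    let i := (tau^-1)%g ord_max in
    if v i == 0 :> nat then x
    else (ffun_upd v i (v i).-1, (tau * perm (@ordS_inj d.+1))%g, ord0)
  else (v, (tau * tperm (inord j.-1) (inord j))%g, j).

Lemma val_ordS n (i : 'I_n.+1) : ordS i = (if i == n :> nat then 0 else i.+1) :> nat.
Proof.
rewrite /=; have [->|ne] := eqVneq (i : nat) n; first by rewrite modnn.
by rewrite modn_small //; have := ltn_ord i; lia.
Qed.

Lemma val_ord_pred n (i : 'I_n.+1) : ord_pred i = (if i == 0 :> nat then n else i.-1) :> nat.
Proof.
rewrite /=; have [->|ne] := eqVneq (i : nat) 0; first by rewrite add0n modn_small.
have -> : (i + n.+1).-1 = i.-1 + n.+1 by lia.
by rewrite modnDr modn_small //; have := ltn_ord i; lia.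
Qed.

Lemma perm_ordS_pred n : (perm (@ordS_inj n) * perm (@ord_pred_inj n) = 1)%g.
Proof. by apply/permP => i; rewrite permM !permE ordSK. Qed.

Lemma perm_ord_predS n : (perm (@ord_pred_inj n) * perm (@ordS_inj n) = 1)%g.
Proof. by apply/permP => i; rewrite permM !permE ord_predK. Qed.

Lemma flipK : involutive flip.
Proof.
case=> [[v tau] j]; rewrite {2}/flip; case: eqVneq => [->|j0].
  case: ifPn => [vm|vm]; first by rewrite /flip eqxx vm.
  move: vm; rewrite /flip /=; set i := (tau^-1)%g ord0 => vm.
  have ti : tau i = ord0 by rewrite permKV.
  have -> : ((tau * perm (@ord_pred_inj d.+1))^-1)%g ord_max = i.
    apply: (canLR (permK _)); rewrite permM permE ti; apply: ord_inj.
    by rewrite val_ord_pred.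
  rewrite eqxx !ffunE eqxx inordK /=; last by have := ltn_ord (v i); lia.
  rewrite -mulgA perm_ord_predS mulg1; congr (_, _, _).
  by apply/ffunP => i'; rewrite !ffunE; case: eqVneq => // ->; rewrite inord_val.
case: eqVneq => [->|jm].
  case: ifPn => [vm|vm]; first by rewrite /flip /= eqxx vm.
  move: vm; rewrite /flip /=; set i := (tau^-1)%g ord_max => vm.
  have ti : tau i = ord_max by rewrite permKV.
  have -> : ((tau * perm (@ordS_inj d.+1))^-1)%g ord0 = i.
    apply: (canLR (permK _)); rewrite permM permE ti; apply: ord_inj.
    by rewrite val_ordS eqxx.
  rewrite !ffunE eqxx inordK /=; last by have := ltn_ord (v i); lia.
  rewrite ifF; last by have := ltn_ord (v i); lia.
  rewrite -mulgA perm_ordS_pred mulg1; congr (_, _, _).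
  apply/ffunP => i'; rewrite !ffunE; case: eqVneq => // ->; apply/val_inj => /=.
  by rewrite inordK; have := ltn_ord (v i); lia.
by rewrite /flip (negbTE j0) (negbTE jm) -mulgA tperm2 mulg1.
Qed.

(** Dropping the first vertex moves the base to the second one and shifts indices down; dropping the
    last vertex shifts them up. In between, exchanging two successive increments changes the marked
    vertex only. *)
Lemma flip_facet x j : flip x != x -> j != x.2 ->
  exists2 j', j' != (flip x).2 & flag_vertex (flip x) j' = flag_vertex x j.
Proof.
case: x => [[v tau] l]; rewrite /flip /=; case: (eqVneq l ord0) => [->|l0].
  set i := (tau^-1)%g ord0.
  have ti : tau i = ord0 by rewrite permKV.
  case: ifPn => [|vm _ j0]; first by rewrite eqxx.
  exists (inord j.-1).
    have := ltn_ord j; have : j != 0 :> nat by [].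
    by move=> ? ?; rewrite -val_eqE /= inordK; lia.
  have := ltn_ord j; have : j != 0 :> nat by [].
  rewrite /flag_vertex /= => jn0 jd; apply/ffunP => i'; rewrite !ffunE inordK; last by lia.
  rewrite permM permE val_ord_pred; case: eqVneq => [->|ne].
    by rewrite ti inordK /=; have := ltn_ord (v i); lia.
  have : tau i' != 0 :> nat.
    by apply: contra_neq ne => e; apply: (@perm_inj _ tau); rewrite ti; apply: ord_inj.
  by case: eqP; lia.
case: (eqVneq l ord_max) => [->|lm].
  set i := (tau^-1)%g ord_max.
  have ti : tau i = ord_max by rewrite permKV.
  case: ifPn => [|vm _ j0]; first by rewrite eqxx.
  have jd : j < d.+1 by move: j0; rewrite -val_eqE /=; have := ltn_ord j; lia.
  exists (inord j.+1).
    by rewrite -val_eqE /= inordK; lia.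
  rewrite /flag_vertex /=; apply/ffunP => i'; rewrite !ffunE inordK; last by lia.
  rewrite permM permE val_ordS; case: eqVneq => [->|ne].
    by rewrite ti /= eqxx inordK; have := ltn_ord (v i); lia.
  have : tau i' != d :> nat.
    by apply: contra_neq ne => e; apply: (@perm_inj _ tau); rewrite ti; apply: ord_inj.
  by case: eqP; lia.
move=> _ jl; exists j => //.
move: l0 lm jl; rewrite -!val_eqE /= => l0 lm jl.
rewrite /flag_vertex /=; apply/ffunP => i; rewrite !ffunE permM; congr (_ + _).
have ll := ltn_ord l.
case: tpermP => [->|->|//]; rewrite !inordK; lia.
Qed.

Lemma flip_fix x : flip x = x ->
  (x.2 = ord0 /\ x.1.1 ((x.1.2)^-1 ord0)%g = m :> nat) \/
  (x.2 = ord_max /\ x.1.1 ((x.1.2)^-1 ord_max)%g = 0 :> nat).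
Proof.
case: x => [[v tau] l]; rewrite /flip /=; case: (eqVneq l ord0) => [->|l0].
  by case: eqP => [|_ [_ _]]; [left|].
case: (eqVneq l ord_max) => [->|lm].
  by case: eqP => [|_ [_ _]]; [right|].
case=> /(canRL (mulKg _)); rewrite mulVg => /permP /(_ (inord l)).
have ll := ltn_ord l; move: l0 lm; rewrite -!val_eqE /= => l0 lm.
by rewrite tpermR perm1 => /(congr1 val); rewrite /= !inordK; lia.
Qed.

End KuhnTriangulation.

(** A strictly increasing map satisfies [i <= s i]; this applies to [s] and to its inverse. *)
Lemma increasing_perm_id n (s : {perm 'I_n}) : {homo s : i j / i < j} -> s = 1%g.
Proof.
have ge_id (t : {perm 'I_n}) : {homo t : i j / i < j} -> forall i : 'I_n, i <= t i.
  move=> tP [k kn]; elim: k kn => [//|k IHk] kn.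
  exact: leq_ltn_trans (IHk (ltnW kn)) (tP (Ordinal (ltnW kn)) (Ordinal kn) _).
move=> sP; apply/permP => i; rewrite perm1; apply/ord_inj/eqP.
rewrite eqn_leq ge_id // andbT -{2}(permK s i); apply: ge_id => j k jk.
rewrite ltnNge; apply/negP; rewrite leq_eqVlt => /orP[/eqP/ord_inj/perm_inj e|/sP].
  by rewrite e ltnn in jk.
by rewrite !permKV ltnNge ltnW.
Qed.

Lemma decreasing_perm_rev n (s : {perm 'I_n}) :
  (forall i j : 'I_n, i < j -> s j < s i) -> s = perm (@rev_ord_inj n).
Proof.
move=> sP; have : (s * perm (@rev_ord_inj n) = 1)%g.
  apply: increasing_perm_id => i j /sP; rewrite !permM !permE /=.
  by have := ltn_ord (s i); lia.
move=> /(congr1 (fun t => t * perm (@rev_ord_inj n))%g); rewrite mul1g -mulgA.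
rewrite (_ : perm _ * perm _ = 1)%g ?mulg1 //.
by apply/permP => i; rewrite permM !permE rev_ordK.
Qed.

(* On the top faces the labels are forced, so that there is a single boundary  *)
(* facet with all the labels but the last. Flips pair off all other such       *)
(* facets, while a simplex that is not fully labelled has zero or two of them. *)
Section CanonicalTop.
Variables (d m : nat) (lab : {ffun 'I_d.+1 -> nat} -> 'I_d.+2).
Local Notation M := m.+1.
Hypothesis lab_bottom : forall v : {ffun 'I_d.+1 -> nat}, (forall i, v i <= M) ->
  forall i, v i = 0 -> lab v != i :> nat.
Hypothesis lab_top : forall v : {ffun 'I_d.+1 -> nat}, (forall i, v i <= M) ->
  forall i, v i = M -> lab v <= i.
Hypothesis lab_top_ex : forall v : {ffun 'I_d.+1 -> nat}, (forall i, v i <= M) ->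
  forall i, v i = M -> exists2 i' : 'I_d.+1, lab v = i' :> nat & v i' = M.

Local Notation flag := ({ffun 'I_d.+1 -> 'I_m.+1} * {perm 'I_d.+1} * 'I_d.+2)%type.

Let flabel (x : {ffun 'I_d.+1 -> 'I_m.+1} * {perm 'I_d.+1}) (j : 'I_d.+2) :=
  lab (flag_vertex (x, ord0) j).

Let P : {set flag} := [set x | full_facet (flabel x.1) x.2].

Let flag_vertex_le (x : flag) j i : flag_vertex x j i <= M.
Proof.
by rewrite ffunE /=; have := ltn_ord (x.1.1 i); lia.
Qed.

Let flip_P : {in P, forall x, flip x \in P}.
Proof.
move=> x xP; have [->//|nfix] := eqVneq (flip x) x.
move: xP; rewrite !inE => /full_facetP F; apply/full_facetP => l /F[i ix <-].
have [j' j'x e] := flip_facet nfix ix; exists j' => //.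
by rewrite /flabel; congr (lab _); exact: e.
Qed.

(** The simplex at the top corner of the grid, incrementing the last coordinate first, with the
    facet opposite its least vertex. *)
Let x0 : flag := ([ffun=> ord_max], perm (@rev_ord_inj d.+1), ord0).

Let fixed_P : [set x in P | flip x == x] = [set x0].
Proof.
apply/setP => x; rewrite !inE; apply/andP/eqP => [[/full_facetP F /eqP fx]|->].
  case: x F fx => [[v tau] l] F fx; have [] := flip_fix fx;
    move: F {fx}; rewrite /= => F [e v0]; subst l; last first.
    (* On a bottom facet all vertices have i-th coordinate 0, so the label [i] is missing. *)
    exfalso; set i := (tau^-1)%g ord_max in v0.
    have ti : tau i = ord_max by rewrite permKV.
    have [|j jmax] := F (widen_ord (leqnSn _) i).
      by rewrite -val_eqE /=; have := ltn_ord i; lia.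
    move=> /(congr1 val); apply/eqP; apply: lab_bottom => [i'|].
      exact: flag_vertex_le.
    rewrite ffunE /= v0 ti ltnNge -ltnS.
    by move: jmax; rewrite -val_eqE /=; have := ltn_ord j; lia.
  set i0 := (tau^-1)%g ord0 in v0; have ti0 : tau i0 = ord0 by rewrite permKV.
  (* On a top facet every label names a coordinate equal to [M]. The vertex labelled [i] thus has
     its i-th coordinate at [M], so [v i = m] and [i] was already incremented there. *)
  have ex i : exists2 j : 'I_d.+2, v i = m :> nat /\ tau i < j &
      lab (flag_vertex (v, tau, ord0) j) = i :> nat.
    have [|j j0 /(congr1 val) /= labj] := F (widen_ord (leqnSn _) i).
      by rewrite -val_eqE /=; have := ltn_ord i; lia.
    exists j => //; have [||i' e] := @lab_top_ex (flag_vertex (v, tau, ord0) j) _ i0.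
    - exact: flag_vertex_le.
    - rewrite ffunE /= v0 ti0 /=.
      by have : j != 0 :> nat by []; lia.
    have -> : i' = i by apply: ord_inj; rewrite -e.
    rewrite ffunE /=; have := ltn_ord (v i); case: (tau i < j) => vi; last first.
      by rewrite addn0 => vM; rewrite vM ltnn in vi.
    by rewrite addn1 => -[].
  have vm i : v i = m :> nat by have [? []] := ex i.
  rewrite /x0; congr (_, _, _); last apply: decreasing_perm_rev => i' i i'i.
    by apply/ffunP => i; apply: ord_inj; rewrite ffunE vm.
  (* At the vertex labelled [i] no smaller coordinate [i'] can have reached [M], so [i'] is
     incremented later than [i]. *)
  have [j [_ tij] labj] := ex i; apply: (leq_trans tij); rewrite leqNgt.
  apply/negP => ti'j; have := @lab_top _ (flag_vertex_le (v, tau, ord0) j) i'.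
  by rewrite ffunE /= vm ti'j addn1 [X in X <= _]labj leqNgt i'i => /(_ erefl).
split; last by rewrite /flip /x0 /= ffunE /= eqxx.
apply/full_facetP => l lmax.
have ld : l < d.+1 by move: lmax; rewrite -val_eqE /=; have := ltn_ord l; lia.
pose i : 'I_d.+1 := Ordinal ld.
have jd : d.+1 - l < d.+2 by lia.
have vi : flag_vertex x0 (Ordinal jd) i = M.
  by rewrite ffunE /= ffunE permE /= subSS (_ : _ < _) ?addn1 //; lia.
exists (Ordinal jd); first by rewrite -val_eqE /=; lia.
have labi : lab (flag_vertex x0 (Ordinal jd)) <= i.
  by apply: lab_top => //; exact: flag_vertex_le.
have [|i' e] := lab_top_ex _ vi; first exact: flag_vertex_le.
rewrite ffunE /= ffunE permE /= subSS => vi'.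
apply: ord_inj; rewrite /flabel /=; apply/eqP; rewrite eqn_leq labi /= e.
move: vi'; case: ltnP => [|_]; last by lia.
by have := ltn_ord i'; lia.
Qed.

(** Flips leave a single fixed full facet, so the number of flags in [P] is odd. Counted simplex by
    simplex it would be even if no simplex carried all the labels. *)
Lemma kuhn_canonical :
  exists (v : {ffun 'I_d.+1 -> 'I_m.+1}) (tau : {perm 'I_d.+1}),
    injective (fun j : 'I_d.+2 => lab (kuhn_vertex (fun i => v i) tau j)).
Proof.
apply: contrapT => H; suff /negP : ~~ odd #|P|.
  by apply; rewrite (odd_card_involution flip_P) ?fixed_P ?cards1 // => x _; exact: flipK.
rewrite -sum1_card (eq_bigl (fun x : flag => full_facet (flabel x.1) x.2)); last first.
  by move=> x; rewrite inE.
rewrite -(pair_big_dep predT (fun s j => full_facet (flabel s) j) (fun _ _ => 1)) /=.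
apply: (big_ind (fun n => ~~ odd n)) => // [a b|s _]; first by rewrite oddD; do 2!case: odd.
have -> : \sum_(j | full_facet (flabel s) j) 1 = #|[set j | full_facet (flabel s) j]|.
  by rewrite -sum1_card; apply: eq_bigl => j; rewrite inE.
apply: even_full_facets => inj; apply: H; case: s inj => v tau inj.
by exists v, tau.
Qed.
End CanonicalTop.

(* The cube is extended by a layer of vertices with a coordinate [N.+1], where *)
(* the label is the first such coordinate. A fully labelled simplex does not   *)
(* meet this layer: its vertices in the cube would lie on a face [v i = N], so *)
(* that the label [d.+1] would be missing.                                     *)
Lemma kuhn_labelling d N (lab : {ffun 'I_d.+1 -> nat} -> 'I_d.+2) :
  (forall v : {ffun 'I_d.+1 -> nat}, (forall i, v i <= N) ->
    forall i, v i = 0 -> lab v != i :> nat) ->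
  (forall v : {ffun 'I_d.+1 -> nat}, (forall i, v i <= N) ->
    forall i, v i = N -> lab v <= i) ->
  exists (v : {ffun 'I_d.+1 -> nat}) (tau : {perm 'I_d.+1}),
    (forall i, v i < N) /\
    injective (fun j : 'I_d.+2 => lab (kuhn_vertex v tau j)).
Proof.
move=> bot top.
pose is_min (v : {ffun 'I_d.+1 -> nat}) (i : 'I_d.+1) :=
  (v i == N.+1) && [forall i' : 'I_d.+1, (v i' == N.+1) ==> (i <= i')].
pose lab' v := if [pick i | is_min v i] is Some i then widen_ord (leqnSn _) i
               else lab v.
have no_min v : (is_min v =1 pred0) -> forall i, v i != N.+1.
  move=> v0 i; apply/negP => vi.
  have [i0 vi0 i0min] := @arg_minnP _ i (fun i => v i == N.+1) val vi.
  have := v0 i0; rewrite /is_min vi0 /= => /forallPn[i'].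
  by rewrite negb_imply => /andP[/i0min /= h]; rewrite h.
have le_noN (v : {ffun 'I_d.+1 -> nat}) :
    (forall i, v i <= N.+1) -> (forall i, v i != N.+1) -> forall i, v i <= N.
  by move=> vM vn i; have := vM i; have := vn i; lia.
have [|||v [tau inj]] := @kuhn_canonical d N lab'.
- move=> v vM i vi; rewrite /lab'; case: pickP => [i' /andP[/eqP vi' _]|/no_min vn].
    by apply: contra_eqN vi => /eqP /= /ord_inj <-; rewrite vi'.
  by apply: bot => //; apply: le_noN.
- move=> v vM i vi; rewrite /lab'; case: pickP => [i' /andP[_ /forallP]|/no_min vn].
    by move=> /(_ i); rewrite vi eqxx.
  by have := vn i; rewrite vi eqxx.
- move=> v vM i vi; rewrite /lab'; case: pickP => [i' /andP[/eqP]|/no_min vn].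
    by exists i'.
  by have := vn i; rewrite vi eqxx.
have vN i : v i < N.
  rewrite ltnNge; apply/negP => Nv.
  have {Nv} vi : v i = N :> nat by have := ltn_ord (v i); lia.
  have [g _ gK] := injF_bij inj.
  have := gK ord_max; rewrite /lab'; case: pickP => [i' _|/no_min vn].
    by move=> /(congr1 val) /=; have := ltn_ord i'; lia.
  set w := kuhn_vertex _ _ _ in vn *; move=> labw.
  have wN : forall i, w i <= N.
    apply: le_noN => // i'; rewrite ffunE.
    by have := ltn_ord (v i'); case: (tau i' < _); lia.
  have := top w wN i; rewrite labw /= leqNgt ltn_ord => H.
  move: H (wN i); rewrite ffunE vi; case: (tau i < _) => /=.
    by rewrite addn1 ltnn.
  by rewrite addn0 => /(_ erefl).
exists [ffun i => nat_of_ord (v i)], tau; split=> [i|]; first by rewrite ffunE.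
move=> j j'.
have labE (j0 : 'I_d.+2) : lab (kuhn_vertex [ffun i => nat_of_ord (v i)] tau j0) =
    lab' (kuhn_vertex (fun i => v i) tau j0).
  have -> : kuhn_vertex [ffun i => nat_of_ord (v i)] tau j0 =
      kuhn_vertex (fun i => v i) tau j0.
    by apply/ffunP => i; rewrite !ffunE.
  rewrite /lab'; case: pickP => // i /andP[/eqP].
  by rewrite ffunE; have := vN i; case: (tau i < _); lia.
by rewrite !labE; apply: inj.
Qed.

Local Open Scope classical_set_scope.
Local Open Scope ring_scope.

(** * The colorful KKM theorem on the cube *)

Definition unit_cube (R : realType) n : set 'rV[R]_n := [set y | forall i, 0 <= y ord0 i <= 1].

Lemma unit_cube_compact (R : realType) n : compact (@unit_cube R n).
Proof.
have -> : @unit_cube R n = [set y | forall i, `[0, 1]%classic (y ord0 i)].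
  by apply/seteqP; split=> y /= h i; have := h i; rewrite in_itv.
by apply: (@rV_compact R _ (fun=> `[0, 1]%classic)) => i; exact: segment_compact.
Qed.

Section ColorfulKKM.
Variables (R : realType) (d : nat) (A : 'I_d.+2 -> 'I_d.+2 -> set 'rV[R]_d.+1).
Hypothesis A_cover : forall j y, unit_cube y -> exists i, A i j y.
Hypothesis A_bottom : forall i (l j : 'I_d.+2) y,
  unit_cube y -> y ord0 i = 0 -> A l j y -> l != i :> nat.
Hypothesis A_top : forall i l j y, unit_cube y -> y ord0 i = 1 -> A l j y -> (l <= i)%N.

(** On the grid of mesh 1/(N+1) a fully labelled simplex has one vertex per label and one per owner;
    matching the label of each vertex to its owner gives the permutation. *)
Lemma colorful_kkm_approx (N : nat) : exists (x : 'rV[R]_d.+1) (pi : {perm 'I_d.+2}),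
  unit_cube x /\ forall i, exists2 y, A i (pi i) y &
    forall c, `|x ord0 c - y ord0 c| <= N.+1%:R^-1.
Proof.
(* The vertices of a simplex have distinct owners. *)
pose owner (v : {ffun 'I_d.+1 -> nat}) : 'I_d.+2 := inord ((\sum_i v i) %% d.+2).
pose point (v : {ffun 'I_d.+1 -> nat}) : 'rV[R]_d.+1 := \row_i ((v i)%:R / N.+1%:R).
pose lab v := xget ord0 [set i | A i (owner v) (point v)].
have N0 : 0 < N.+1%:R :> R by [].
have cubeP (v : {ffun 'I_d.+1 -> nat}) : (forall i, v i <= N.+1)%N -> unit_cube (point v).
  by move=> vN i; rewrite mxE divr_ge0 //= ler_pdivrMr // mul1r ler_nat.
have labP (v : {ffun 'I_d.+1 -> nat}) : (forall i, v i <= N.+1)%N -> A (lab v) (owner v) (point v).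
  move=> /cubeP /(A_cover (owner v)) [i Ai].
  exact: (@xgetPex _ ord0 [set i | A i (owner v) (point v)] (ex_intro _ i Ai)).
have [||v [tau [vN inj]]] := @kuhn_labelling d N.+1 lab.
- move=> v vN i vi; apply: (@A_bottom i _ (owner v) (point v)).
  + exact: cubeP.
  + by rewrite mxE vi mul0r.
  + exact: labP.
- move=> v vN i vi; apply: (@A_top i _ (owner v) (point v)).
  + exact: cubeP.
  + by rewrite mxE vi divff.
  + exact: labP.
have vertN (j : 'I_d.+2) i : (kuhn_vertex v tau j i <= N.+1)%N.
  by rewrite ffunE; have := vN i; case: (tau i < j)%N; lia.
have ownerE (j : 'I_d.+2) : owner (kuhn_vertex v tau j) = inord ((\sum_i v i + j) %% d.+2).
  rewrite /owner; congr (inord (_ %% _)).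
  under eq_bigr do rewrite ffunE.
  rewrite big_split /=; congr addn.
  rewrite (reindex_inj (@perm_inj _ tau^-1%g)) /=.
  under eq_bigr do rewrite permKV.
  rewrite (eq_bigr (fun i : 'I_d.+1 => if (i < j)%N then 1%N else 0%N)); last first.
    by move=> i _; case: ifP.
  have jd : (j <= d.+1)%N by rewrite -ltnS.
  by rewrite -big_mkcond -(big_ord_widen _ (fun=> 1%N) jd) sum1_card card_ord.
have [g gK gK'] := injF_bij inj.
have piinj : injective (fun i => owner (kuhn_vertex v tau (g i))).
  move=> i i'; rewrite !ownerE => /(congr1 val).
  rewrite /= !inordK ?ltn_pmod // => /eqP; rewrite eqn_modDl !modn_small // => /eqP /ord_inj.
  exact: (can_inj gK').
exists (point v), (perm piinj); split.
  by apply: cubeP => i; apply: ltnW.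
move=> i; exists (point (kuhn_vertex v tau (g i))).
  by rewrite permE -{1}(gK' i); apply: labP.
move=> c; rewrite !mxE !ffunE -mulrBl normrM normfV natrD opprD addrA subrr add0r normrN.
rewrite [`|N.+1%:R|]ger0_norm // -[leRHS]mul1r ler_pM2r ?invr_gt0 //.
by case: (_ < _)%N; rewrite ?normr1 ?normr0.
Qed.

Hypothesis A_closed : forall i j, closed (A i j).

(** Let [x] be a cluster point of approximate solutions. If every permutation failed at [x], then,
    the sets being closed and the permutations finitely many, all would fail on one ball around [x],
    which contains the points of some approximate solution. *)
Lemma colorful_kkm_ord : exists (x : 'rV[R]_d.+1) (pi : {perm 'I_d.+2}),
  unit_cube x /\ forall i, A i (pi i) x.
Proof.
have [x_ /choice[pi_ xpi]] := choice colorful_kkm_approx.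
have [|x [cx clx]] := @unit_cube_compact R d.+1 (x_ @ \oo) _.
  by exists 0%N => // N _; have [] := xpi N.
apply: contrapT => nex.
have /choice[i_ iP] : forall pi : {perm 'I_d.+2}, exists i, ~ A i (pi i) x.
  move=> pi; apply: contrapT => h; apply: nex; exists x, pi; split => // i.
  by apply: contrapT => nA; apply: h; exists i.
have near_x pi : \forall y \near x, ~ A (i_ pi) (pi (i_ pi)) y.
  have /closed_openC : closed (A (i_ pi) (pi (i_ pi))) by exact: A_closed.
  by rewrite openE => /(_ x (iP pi)).
have : nbhs x [set y | forall pi, ~ A (i_ pi) (pi (i_ pi)) y].
  exact: (@filter_forall _ {perm 'I_d.+2}
    (fun (pi : {perm 'I_d.+2}) y => ~ A (i_ pi) (pi (i_ pi)) y) (nbhs x) _ near_x).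
move=> /nbhs_ballP[e /= e0 eP].
have [N0 _ N0P] : \forall N \near \oo, N.+1%:R^-1 < e / 2 :> R.
  exact: (near_infty_natSinv_lt (PosNum (divr_gt0 e0 (ltr0n _ 2)))).
have [] := clx [set y | exists2 N, (N0 <= N)%N & y = x_ N] (ball x (e / 2)).
- by exists N0 => // N /= N0N; exists N.
- by apply: nbhsx_ballx; rewrite divr_gt0.
move=> _ [[N N0N ->] xN].
have [_ /(_ (i_ (pi_ N)))[y Ay yN]] := xpi N.
apply: (eP y) Ay; apply: ball_splitl (xN) _; split; first by rewrite divr_gt0.
move=> a c; rewrite (ord1 a) /ball /= distrC.
by apply: (le_lt_trans (yN c)); apply: N0P.
Qed.
End ColorfulKKM.

(* [n] is kept apart from [d.+2] so that the theorem applies when [n] is [2 * k]. *)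
Theorem colorful_kkm (R : realType) (d n : nat) (A : 'I_n -> 'I_n -> set 'rV[R]_d.+1) :
  n = d.+2 -> (forall i j, closed (A i j)) ->
  (forall j y, unit_cube y -> exists i, A i j y) ->
  (forall i (l j : 'I_n) y, unit_cube y -> y ord0 i = 0 -> A l j y -> l != i :> nat) ->
  (forall i (l j : 'I_n) y, unit_cube y -> y ord0 i = 1 -> A l j y -> (l <= i)%N) ->
  exists (x : 'rV[R]_d.+1) (pi : {perm 'I_n}), unit_cube x /\ forall i, A i (pi i) x.
Proof.
move=> nd; subst n => A_closed A_cover A_bottom A_top.
exact: colorful_kkm_ord.
Qed.

(** * Chords and regions *)

Section Chord.
Variable R : realType.
Implicit Types (a b r t : R) (p q : R * R).

(* Signed distance to the line through the points of angles [a] and [b] of the *)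
(* circle of radius [r], positive on the side of the arc from [a] to [b]; this *)
(* line is a tangent when [b = a] or [b = a + 2 * pi].                         *)
Definition chord a b r p : R :=
  p.1 * cos ((a + b) / 2) + p.2 * sin ((a + b) / 2) - r * cos ((b - a) / 2).

(** An instance of cos(x-y) - cos(x+y) = 2 sin x sin y; it lets signs on the circle be read off the
    order of the angles. *)
Lemma chord_circle a b r t :
  chord a b r (circle_point (0, 0) r t) = 2 * r * (sin ((t - a) / 2) * sin ((b - t) / 2)).
Proof.
rewrite /chord /circle_point /= !add0r.
have -> : (b - a) / 2 = (t - a) / 2 + (b - t) / 2 by field.
have tE : t = (a + b) / 2 + ((t - a) / 2 - (b - t) / 2) by field.
set x := (t - a) / 2 in tE *; set y := (b - t) / 2 in tE *; set m := (a + b) / 2 in tE *.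
have e : cos (x - y) = cos t * cos m + sin t * sin m.
  by rewrite -cosB; congr cos; rewrite tE; ring.
transitivity (r * (cos t * cos m + sin t * sin m) - r * cos (x + y)); first by ring.
by rewrite -e cosB cosD; ring.
Qed.

Lemma chord_continuous a b r : continuous (chord a b r).
Proof.
move=> p; apply: cvgB; last exact: cvg_cst.
by apply: cvgD; apply: cvgMl; [exact: cvg_fst|exact: cvg_snd].
Qed.

Lemma chord_half_turn a b r p : chord b (a + 2 * pi) r p = - chord a b r p.
Proof.
rewrite /chord; have -> : (b + (a + 2 * pi)) / 2 = (a + b) / 2 + pi by field.
have -> : (a + 2 * pi - b) / 2 = - ((b - a) / 2) + pi by field.
by rewrite !cosDpi sinDpi cosN; ring.
Qed.

Lemma chord_conv a b r p q (l : R) :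
  chord a b r (l *: p + (1 - l) *: q) = l * chord a b r p + (1 - l) * chord a b r q.
Proof. by rewrite /chord /= /GRing.scale /=; ring. Qed.

(** Moving from [p] by e/2 along the unit normal changes the value of the chord by e/2. *)
Lemma chord_line_no_interior a b r p : ~ nbhs p [set q | chord a b r q = 0].
Proof.
move=> pn; have p0 := nbhs_singleton pn.
have /nbhs_ballP[e /= e0 eP] := pn.
pose q := (p.1 + e / 2 * cos ((a + b) / 2), p.2 + e / 2 * sin ((a + b) / 2)).
have bd (x y : R) : `|x| <= 1 -> ball y e (y + e / 2 * x).
  move=> x1; rewrite /ball /= opprD addrA subrr sub0r normrN normrM.
  rewrite (ger0_norm (ltW _)) ?divr_gt0 //.
  by apply: (@le_lt_trans _ _ (e / 2)); [rewrite ler_piMr ?divr_ge0 // ltW|lra].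
have : chord a b r q = 0 by apply: eP; split; apply: bd; [exact: cos_max|exact: sin_max].
have := cos2Dsin2 ((a + b) / 2); move: p0; rewrite /chord /q /=; nra.
Qed.

(** In coordinates rotated by [a] and scaled by [r], the angle is [acos x] or its reflection,
    according to the sign of [y]. *)
Lemma circle_point_surj r p a : 0 < r -> circle (0, 0) r p ->
  exists2 t, a <= t < a + 2 * pi & p = circle_point (0, 0) r t.
Proof.
move=> r0; rewrite /circle /= !subr0 => pr.
have rn0 : r != 0 by rewrite gt_eqF.
pose x := (p.1 * cos a + p.2 * sin a) / r; pose y := (p.2 * cos a - p.1 * sin a) / r.
have ca := cos2Dsin2 a.
have xy1 : x ^+ 2 + y ^+ 2 = 1.
  have -> : x ^+ 2 + y ^+ 2 = (p.1 ^+ 2 + p.2 ^+ 2) * (cos a ^+ 2 + sin a ^+ 2) / r ^+ 2.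
    by rewrite /x /y; field.
  by rewrite pr ca mulr1 divff // expf_neq0.
have x1 : -1 <= x <= 1 by nra.
have pE : p = (r * (x * cos a - y * sin a), r * (x * sin a + y * cos a)).
  rewrite [LHS]surjective_pairing; congr pair.
    transitivity (p.1 * (cos a ^+ 2 + sin a ^+ 2)); first by rewrite ca mulr1.
    by rewrite /x /y; field.
  transitivity (p.2 * (cos a ^+ 2 + sin a ^+ 2)); first by rewrite ca mulr1.
  by rewrite /x /y; field.
suff [t t2 [xt yt]] : exists2 t : R, 0 <= t < 2 * pi & x = cos t /\ y = sin t.
  exists (a + t); first by lra.
  rewrite pE /circle_point cosD sinD /= !add0r xt yt.
  by congr pair; ring.
have a0 := acos_ge0 x1; have ap := acos_lepi x1; have pi0 := pi_gt0 R.
have xc : cos (acos x) = x by rewrite acosK // in_itv.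
have sy : sin (acos x) = `|y| by rewrite sin_acos // (_ : 1 - x ^+ 2 = y ^+ 2) ?sqrtr_sqr //; lra.
have [y0|y0] := leP 0 y.
  by exists (acos x); [lra | rewrite xc sy ger0_norm].
exists (- acos x + pi *+ 2).
  rewrite mulr2n.
  have : 0 < acos x by apply: acos_gt0; nra.
  by lra.
by rewrite cosD2pi sinD2pi cosN sinN xc sy ltr0_norm // opprK.
Qed.

(* If [u], [w] are the coordinates of [p] along [a], the value of the chord at *)
(* [p] is [(u - r) cos B + w sin B] for the half-angle [B] of the chord; then  *)
(* eliminate [w] between the two chords.                                       *)
Lemma chord_degenerate a b b' r p : 0 < r -> p.1 ^+ 2 + p.2 ^+ 2 <= r ^+ 2 ->
  a <= b -> b <= b' -> b' <= a + 2 * pi -> 0 < chord a b r p -> chord a b' r p < 0 -> False.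
Proof.
move=> r0 pr ab bb' b'a.
have pi0 := pi_gt0 R.
pose u := p.1 * cos a + p.2 * sin a; pose w := p.2 * cos a - p.1 * sin a.
have chordE c : chord a c r p = (u - r) * cos ((c - a) / 2) + w * sin ((c - a) / 2).
  rewrite /chord /u /w (_ : (a + c) / 2 = a + (c - a) / 2); last by field.
  by rewrite cosD sinD; ring.
have ur : u <= r.
  have : u ^+ 2 + w ^+ 2 = (p.1 ^+ 2 + p.2 ^+ 2) * (cos a ^+ 2 + sin a ^+ 2).
    by rewrite /u /w; ring.
  rewrite cos2Dsin2 mulr1 => uw; rewrite leNgt; apply/negP => ru; nra.
rewrite !chordE; set B := (b - a) / 2; set B' := (b' - a) / 2.
have B0 : 0 <= B by rewrite /B; lra.
have BB' : B <= B' by rewrite /B /B'; lra.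
have B'pi : B' <= pi by rewrite /B'; lra.
have s0 : 0 <= sin B by apply: sin_ge0_pi; lra.
have s'0 : 0 <= sin B' by apply: sin_ge0_pi; lra.
have sBB' : 0 <= sin B' * cos B - cos B' * sin B by rewrite -sinB; apply: sin_ge0_pi; lra.
move=> h h'.
(* If B = 0 the first chord is the tangent at [a], nowhere positive on the disc; if B = pi the two
   chords coincide. *)
have [sB|sB] : sin B = 0 \/ 0 < sin B by move: s0; rewrite le_eqVlt => /orP[/eqP|]; [left|right].
  have : ~~ (0 < B < pi) by apply/negP => /sin_gt0_pi; rewrite sB ltxx.
  rewrite negb_and -!leNgt => /orP[B0'|Bpi].
    have Be : B = 0 by apply/le_anti; rewrite B0 B0'.
    by move: h; rewrite Be cos0 sin0 mulr1 mulr0 addr0 subr_gt0 ltNge ur.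
  have Be : B = B' by apply/le_anti; rewrite BB' (le_trans B'pi).
  by move: h; rewrite Be ltNge ltW.
have : 0 <= (r - u) * (sin B' * cos B - cos B' * sin B) by rewrite mulr_ge0 // subr_ge0.
have : 0 < - ((u - r) * cos B' + w * sin B') * sin B by rewrite mulr_gt0 // oppr_gt0.
have : 0 <= ((u - r) * cos B + w * sin B) * sin B' by rewrite mulr_ge0 // ltW.
lra.
Qed.

End Chord.

Section Regions.
Variables (R : realType) (k : nat) (theta : nat -> R) (r : R).
Hypothesis k0 : (0 < k)%N.
Hypothesis theta_turn : forall m, theta (m + 2 * k)%N = theta m + 2 * pi.

Definition chord_at m : R * R -> R := chord (theta m) (theta (m + k)) r.
Local Notation h := chord_at.

(* For [i < k] the signs select the half-plane [h 0 >= 0], for [k <= i < 2k]   *)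
(* its complement, since [h k = - h 0]; [k * (i %/ k)] is [0] or [k].          *)
Definition region (i : nat) : set (R * R) :=
  [set p | (forall m, (k * (i %/ k) <= m <= i)%N -> 0 <= h m p) /\ h i.+1 p <= 0].

Lemma chord_at_half_turn m p : h (m + k) p = - h m p.
Proof. by rewrite /h -addnA addnn -mul2n theta_turn chord_half_turn. Qed.

Lemma chord_at_mod m p : (h m p == 0) = (h (m %% k) p == 0).
Proof.
rewrite {1}(divn_eq m k) addnC; elim: (m %/ k)%N => [|q IHq]; first by rewrite mul0n addn0.
by rewrite mulSn addnCA addnC chord_at_half_turn oppr_eq0.
Qed.

(** The index is the last one before the sign first becomes nonpositive, which happens within [k]
    steps. *)
Lemma region_from b p : 0 <= h b p -> h (b + k) p <= 0 ->
  exists2 i, (b <= i < b + k)%N & (forall m, (b <= m <= i)%N -> 0 <= h m p) /\ h i.+1 p <= 0.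
Proof.
move=> hb hbk.
have ex : exists j, h (b + j).+1 p <= 0 by exists k.-1; rewrite -addnS prednK.
have [j hj jmin] := ex_minnP ex.
exists (b + j)%N.
  rewrite leq_addr ltn_add2l -[ltnRHS](prednK k0) ltnS /=; apply: jmin.
  by rewrite -addnS prednK.
split => // m /andP[bm mj]; have [->//|bm'] := eqVneq m b.
have {bm bm'} bm : (b < m)%N by lia.
rewrite leNgt; apply/negP => hm.
have := jmin (m - b).-1; rewrite (_ : (b + (m - b).-1).+1 = m); last by lia.
by move=> /(_ (ltW hm)); lia.
Qed.

Lemma region_cover p : exists2 i, (i < 2 * k)%N & region i p.
Proof.
have [hp|hp] := leP 0 (h 0%N p).
  have [|i /andP[_ ik] [pos neg]] := @region_from 0 p hp.
    by rewrite chord_at_half_turn oppr_le0.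
  by exists i; [lia|split => // m; rewrite divn_small // muln0; apply: pos].
have [||i /andP[ki ik] [pos neg]] := @region_from k p.
- by rewrite -[k]add0n chord_at_half_turn oppr_ge0 ltW.
- by rewrite chord_at_half_turn -[k]add0n chord_at_half_turn opprK ltW.
have ik1 : (i %/ k = 1)%N.
  have -> : i = (1 * k + (i - k))%N by lia.
  by rewrite divnMDl // divn_small //; lia.
by exists i; [lia|split => // m; rewrite ik1 muln1; apply: pos].
Qed.

(** In the same half-plane the line of index [i.+1] separates the two regions, since it is one of
    the lines bounding region [j] from the other side; in opposite half-planes the line of index 0
    does. *)
Lemma region_inter i j : (i < j)%N -> (j < 2 * k)%N ->
  exists m, region i `&` region j `<=` [set p | h m p = 0].
Proof.
move=> ij jk; have [e|ne] := eqVneq (i %/ k)%N (j %/ k)%N.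
  exists i.+1 => p [[_ hi] [hj _]] /=; apply/le_anti; rewrite hi hj // ij andbT -e mulnC.
  by rewrite (leq_trans (leq_divM _ _)).
have := leq_div2r k (ltnW ij); have : (j %/ k < 2)%N by rewrite ltn_divLR.
set b := (i %/ k)%N in ne *; set c := (j %/ k)%N in ne * => c2 bc.
have {ne bc c2} [ik jk1] : b = 0%N /\ c = 1%N by clearbody b c; lia.
exists 0%N => p [[hi _] [hj _]] /=; apply/le_anti.
rewrite hi -?/b ?ik ?muln0 // andbT -oppr_ge0 -chord_at_half_turn hj // -/c jk1 muln1 leqnn.
by have := leq_divM j k; rewrite -/c jk1 mul1n.
Qed.

Lemma region_closed i : closed (region i).
Proof.
have -> : region i = \bigcap_(m in [set m | (k * (i %/ k) <= m <= i)%N]) [set p | 0 <= h m p]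
    `&` [set p | h i.+1 p <= 0].
  by apply/seteqP; split.
apply: closedI; last first.
  apply: (@preimage_closed _ _ (h i.+1) [set x | x <= 0]); last exact: closed_le.
  by move=> p _; exact: chord_continuous.
apply: closed_bigI => m _.
apply: (@preimage_closed _ _ (h m) [set x | 0 <= x]); last exact: closed_ge.
by move=> p _; exact: chord_continuous.
Qed.

Lemma region_convex i : convex_set (region i).
Proof.
move=> p q l; rewrite !inE => -[hp hp'] [hq hq'].
have l0 : 0 <= l%:num by [].
have l1 : 0 <= 1 - l%:num by rewrite subr_ge0.
split=> [m mi|]; rewrite /h chord_conv.
  by rewrite addr_ge0 // mulr_ge0 //; [exact: hp|exact: hq].
by rewrite -oppr_ge0 opprD addr_ge0 // -mulrN mulr_ge0 // oppr_ge0.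
Qed.

(** At a point of the region lying on none of the lines, the finitely many defining inequalities are
    strict and so persist nearby. *)
Lemma region_boundary i p : boundary (region i) p -> exists2 m, (m < k)%N & h m p = 0.
Proof.
rewrite /boundary -(iffLR (closure_id _) (@region_closed i)) => -[[pos neg] pint].
apply: contrapT => nex; apply: pint.
have hn0 m : h m p != 0.
  rewrite chord_at_mod; apply/eqP => e; apply: nex; exists (m %% k)%N => //.
  by rewrite ltn_pmod.
have hpos (m : 'I_i.+1) : \forall q \near p, (k * (i %/ k) <= m)%N -> 0 <= h m q.
  have [im|im] := leqP (k * (i %/ k))%N m; last first.
    by apply: (@filterS _ (nbhs p) (nbhs_filter p) setT) => [q _ //|];
      exact: (@filterT _ (nbhs p) (nbhs_filter p)).
  have hm : 0 < h m p by rewrite lt_neqAle eq_sym hn0 pos // im -ltnS ltn_ord.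
  have hm_near := cvgr_gt _ (@chord_continuous R (theta m) (theta (m + k)%N) r p) _ hm.
  by apply: (@filterS _ (nbhs p) (nbhs_filter p) _ _ _ (hm_near (nbhs_filter p))) => q /ltW.
have hneg : \forall q \near p, h i.+1 q < 0.
  have hi : h i.+1 p < 0 by rewrite lt_neqAle hn0 neg.
  have H := cvgr_lt _ (@chord_continuous R (theta i.+1) (theta (i.+1 + k)%N) r p) _ hi. exact: H.
have {}hpos := @filter_forall _ _ (fun (m : 'I_i.+1) q => (k * (i %/ k) <= m)%N -> 0 <= h m q)
  (nbhs p) (nbhs_filter p) hpos.
apply: (@filterS2 _ (nbhs p) (nbhs_filter p) _ _ _ _ hpos hneg) => q qpos qneg.
split; last exact: ltW.
by move=> m /andP[im mi]; have := qpos (Ordinal (mi : m < i.+1)%N); apply.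
Qed.

Hypothesis r0 : 0 < r.

(** The chords [h i] and [h i.+1] start at the same point of the circle. Within the disc, the cap
    over the shorter arc lies in the cap over the longer one, so the two inequalities cannot both be
    strict. *)
Lemma region_degenerate i p : (forall m, theta m <= theta m.+1) -> theta i = theta i.+1 ->
  p.1 ^+ 2 + p.2 ^+ 2 <= r ^+ 2 -> region i p -> h i p = 0 \/ h i.+1 p = 0.
Proof.
move=> mono e pr [pos neg].
have {}mono := homo_leq (@le_refl _ R) (@le_trans _ R) mono.
have hi : 0 <= h i p by apply: pos; rewrite mulnC leq_divM leqnn.
apply: contrapT => /not_orP[hi0 hi1].
have hi' : 0 < h i p by rewrite lt_neqAle eq_sym hi andbT; apply/eqP.
have neg' : h i.+1 p < 0 by rewrite lt_neqAle neg andbT; apply/eqP.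
move: neg'; rewrite /h -e.
apply: (@chord_degenerate _ _ (theta (i + k)%N)) => //; rewrite -?theta_turn; apply: mono; lia.
Qed.

Section Strict.
Hypothesis theta_lt : forall m, theta m < theta m.+1.

Let theta_mono : {homo theta : m n / (m < n)%N >-> m < n}.
Proof. exact: homo_ltn (@lt_trans _ R) theta_lt. Qed.

Let theta_le : {homo theta : m n / (m <= n)%N >-> m <= n}.
Proof. by move=> m n; rewrite leq_eqVlt => /orP[/eqP->//|/theta_mono/ltW]. Qed.

Let sin_half_ge0 (x : R) : 0 <= x <= 2 * pi -> 0 <= sin (x / 2).
Proof. by move=> h; apply: sin_ge0_pi; lra. Qed.

Let sin_half_gt0 (x : R) : 0 < x < 2 * pi -> 0 < sin (x / 2).
Proof. by move=> h; apply: sin_gt0_pi; lra. Qed.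

(** For an angle within one turn from [theta i], the condition [h i >= 0] means lying before
    [theta (i + k)], and [h i.+1 <= 0] then excludes what lies beyond [theta i.+1]. Conversely the
    i-th arc lies inside the arc of each chord [h m] required to be nonnegative. *)
Lemma region_circle i :
  region i `&` circle (0, 0) r = circle_point (0, 0) r @` `[theta i, theta i.+1].
Proof.
have r2 : 0 < 2 * r by rewrite mulr_gt0.
apply/seteqP; split=> [p [[pos neg] pr]|_ [t /= tI <-]].
  have [t /andP[it ti] pE] := circle_point_surj (theta i) r0 pr.
  exists t => //; rewrite /= in_itv /= it /=.
  have := pos i; rewrite mulnC leq_divM leqnn => /(_ isT).
  rewrite pE /h chord_circle pmulr_rge0 // => hi.
  move: neg; rewrite pE /h chord_circle pmulr_rle0 // => hi1.
  have tik : t <= theta (i + k)%N.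
    rewrite leNgt; apply/negP => ikt; move: hi; rewrite leNgt => /negP; apply.
    have iik : theta i < theta (i + k)%N by apply: theta_mono; lia.
    rewrite -[(theta _ - t) / 2]opprK sinN mulrN oppr_lt0 -mulNr opprB.
    by rewrite mulr_gt0 //; apply: sin_half_gt0; lra.
  (* For k = 1 the bound just obtained is already [theta i.+1]; the strict inequality [h2] below
     needs k > 1. *)
  have [k1|k1] := eqVneq k 1%N; first by rewrite k1 addn1 in tik.
  rewrite leNgt; apply/negP => i1t; move: hi1; rewrite leNgt => /negP; apply.
  have h1 : theta (i + k)%N < theta (i.+1 + k)%N by apply: theta_mono; lia.
  have h2 : theta (i.+1 + k)%N < theta i + 2 * pi by rewrite -theta_turn; apply: theta_mono; lia.
  have h3 := theta_lt i.
  by rewrite mulr_gt0 //; apply: sin_half_gt0; lra.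
move: tI; rewrite in_itv /= => /andP[it ti1]; split; last first.
  rewrite /circle /circle_point /= !add0r !subr0 !exprMn -mulrDr.
  by rewrite cos2Dsin2 mulr1.
split=> [m /andP[im mi]|]; rewrite /h chord_circle.
  have h1 : theta m <= theta i by apply: theta_le; lia.
  have h2 : theta i.+1 <= theta (m + k)%N.
    apply: theta_le; apply: (@leq_trans (k * (i %/ k) + k)); last by rewrite leq_add2r.
    by rewrite {1}(divn_eq i k) mulnC ltn_add2l ltn_pmod.
  have h3 : theta (m + k)%N <= theta m + 2 * pi by rewrite -theta_turn; apply: theta_le; lia.
  by rewrite mulr_ge0 ?(ltW r2) // mulr_ge0 //; apply: sin_half_ge0; lra.
have h1 : theta i.+1 <= theta i + 2 * pi by rewrite -theta_turn; apply: theta_le; lia.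
have h2 : theta (i.+1 + k)%N <= theta i + 2 * pi by rewrite -theta_turn; apply: theta_le; lia.
have h3 : theta i.+1 <= theta (i.+1 + k)%N by apply: theta_le; lia.
rewrite -oppr_ge0 -mulrN mulr_ge0 ?(ltW r2) // -mulNr -sinN -mulNr opprB.
by rewrite mulr_ge0 //; apply: sin_half_ge0; lra.
Qed.

(** The endpoints of the two chords alternate strictly on the circle, so the point of angle
    [theta m] is off the second line. *)
Lemma chord_at_line_neq m n : (m < n)%N -> (n < k)%N -> 
  [set p | h m p = 0] <> [set p | h n p = 0].
Proof.
move=> mn nk e; have : [set p | h m p = 0] (circle_point (0, 0) r (theta m)).
  by rewrite /= /h chord_circle subrr mul0r sin0 mul0r mulr0.
rewrite e /= /h chord_circle => /eqP.
have h1 := theta_mono mn.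
have h2 : theta n < theta m + 2 * pi by rewrite -theta_turn; apply: theta_mono; lia.
have h3 : theta m < theta (n + k)%N by apply: theta_mono; lia.
have h4 : theta (n + k)%N < theta m + 2 * pi by rewrite -theta_turn; apply: theta_mono; lia.
rewrite -oppr_eq0 -mulrN -mulNr -sinN -mulNr opprB => /eqP.
apply/eqP; rewrite gt_eqF // !mulr_gt0 //; apply: sin_half_gt0; lra.
Qed.

Theorem regions_partition :
  [/\ convex_partition (fun i : 'I_(2 * k) => region i),
      uses_lines k (fun i : 'I_(2 * k) => region i) &
      counterclockwise_order (fun i : 'I_(2 * k) => region i)].
Proof.
split.
- split.
  + by move=> i; exact: region_closed.
  + by move=> i; exact: region_convex.
  + apply/seteqP; split => // p _; have [i ik ip] := region_cover p.
    by exists (Ordinal ik).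
  + suff H (i j : 'I_(2 * k)) : (i < j)%N -> ~ ((region i)° `&` (region j)° !=set0).
      move=> i j _ _ ne; apply: ord_inj; case: (ltngtP i j) => // ij.
        by case: (H _ _ ij).
      by case: (H _ _ ij); rewrite setIC.
    move=> ij [p [pi pj]]; have [m mP] := region_inter ij (ltn_ord j).
    apply: (@chord_line_no_interior R (theta m) (theta (m + k)%N) r p).
    by apply: filterS2 pi pj => q qi qj; apply: mP.
- exists (fun j : 'I_k => [set p | h j p = 0]); split.
  + move=> i j /= e; apply: ord_inj; case: (ltngtP i j) => // ij.
      by case: (chord_at_line_neq ij (ltn_ord j)).
    by case: (chord_at_line_neq ij (ltn_ord i)).
  + move=> j; exists (cos ((theta j + theta (j + k)%N) / 2)),
      (sin ((theta j + theta (j + k)%N) / 2)), (r * cos ((theta (j + k)%N - theta j) / 2)); split.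
      move=> [c0 s0]; have := cos2Dsin2 ((theta j + theta (j + k)%N) / 2).
      by rewrite c0 s0 !expr0n /= addr0 => /esym/eqP; rewrite oner_eq0.
    by apply/seteqP; split => p /=; rewrite /h /chord; lra.
  + move=> i p /region_boundary[m mk hm]; by exists (Ordinal mk).
- exists (0, 0), r, theta; split => //; last by move=> i; exact: region_circle.
  by have := theta_turn 0; rewrite add0n.
Qed.

End Strict.
End Regions.

(** * Measures on the plane *)

Section PlaneMeasure.
Variable R : realType.
Local Notation plane := (measurableTypeR R * measurableTypeR R)%type.

Lemma measurable_chord (a b r : R) :
  measurable_fun setT (chord a b r : plane -> measurableTypeR R).
Proof.
apply: measurable_funB => //; apply: measurable_funD; exact: measurable_funM.
Qed.

Lemma measurable_chord_preimage (a b r : R) (B : set (measurableTypeR R)) :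
  measurable B -> measurable ([set p | B (chord a b r p)] : set plane).
Proof.
by move=> mB; rewrite -[X in measurable X]setTI; exact: measurable_chord.
Qed.

(** A vertical line is the product of a null set with the real line; any other line has single
    points as vertical sections. *)
Lemma plane_lebesgue_chord (a b r : R) :
  plane_lebesgue R [set p | chord a b r p = 0] = 0%E.
Proof.
set c := cos ((a + b) / 2); set s := sin ((a + b) / 2).
pose d := r * cos ((b - a) / 2).
have -> : [set p | chord a b r p = 0] = [set p : R * R | p.1 * c + p.2 * s = d].
  by apply/seteqP; split => p /=; rewrite /chord -/c -/s -/d => h; lra.
have [s0|s0] := eqVneq s 0.
  have c0 : c != 0.
    apply/eqP => c0; have := cos2Dsin2 ((a + b) / 2).
    by rewrite -/c -/s c0 s0 !expr0n /= addr0 => /esym/eqP; rewrite oner_eq0.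
  have -> : [set p : R * R | p.1 * c + p.2 * s = d] = [set d / c] `*` setT.
    apply/seteqP; split => p /=; rewrite s0 mulr0 addr0.
      by move=> <-; rewrite mulfK.
    by move=> [-> _]; rewrite mulfVK.
  have := @product_measure1E _ _ _ _ R (@lebesgue_measure R) (@lebesgue_measure R)
    _ _ (measurable_set1 (d / c)) measurableT.
  move=> e; apply: (etrans e); apply/eqP; rewrite mule_eq0; apply/orP; left; apply/eqP.
  exact: lebesgue_measure_set1.
apply: integral0_eq => x _ /=.
rewrite (_ : xsection _ _ = [set (d - x * c) / s]) ?lebesgue_measure_set1 //.
apply/seteqP; split => y; rewrite /xsection /= inE /=.
  by move=> <-; rewrite addrAC subrr add0r mulfK.
by move=> ->; rewrite mulfVK // addrC subrK.
Qed.

(** A countable base of the topology made of measurable rectangles, linking open sets to the product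
    sigma-algebra. *)
Definition rat_box (q : (rat * rat) * (rat * rat)) : set (R * R) :=
  `]ratr q.1.1, ratr q.1.2[%classic `*` `]ratr q.2.1, ratr q.2.2[%classic.

Lemma measurable_rat_box q : measurable (rat_box q : set plane).
Proof. by apply: measurableX; exact: measurable_itv. Qed.

Lemma open_rat_box (U : set (R * R)) p : open U -> U p ->
  exists2 q, rat_box q p & rat_box q `<=` U.
Proof.
rewrite openE => /(_ p) /[apply] /nbhs_ballP[e /= e0 eU].
have [q1] := @rat_in_itvoo R (p.1 - e) p.1 (ltac:(lra)).
have [q2] := @rat_in_itvoo R p.1 (p.1 + e) (ltac:(lra)).
have [q3] := @rat_in_itvoo R (p.2 - e) p.2 (ltac:(lra)).
have [q4] := @rat_in_itvoo R p.2 (p.2 + e) (ltac:(lra)).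
rewrite !in_itv /= => /andP[? ?] /andP[? ?] /andP[? ?] /andP[? ?].
exists ((q1, q2), (q3, q4)); first by split; rewrite /= in_itv /=; apply/andP.
move=> x [] /=; rewrite !in_itv /= => /andP[? ?] /andP[? ?]; apply: eU.
by split; rewrite /ball /= ltr_norml; apply/andP; split; lra.
Qed.

Lemma bigcup_rat_boxP (U : set (R * R)) (D : set ((rat * rat) * (rat * rat))) :
  (forall p, U p <-> exists2 q, D q & rat_box q p) ->
  exists2 F : nat -> set plane, (forall n, F n = set0 \/ exists2 q, D q & F n = rat_box q) &
    U = \bigcup_n F n.
Proof.
move=> UP.
exists (fun n => if unpickle n is Some q then (if q \in D then rat_box q else set0) else set0).
  move=> n; case: (unpickle n) => [q|]; last by left.
  by case: ifPn => [/set_mem Dq|_]; [right; exists q|left].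
apply/seteqP; split => p.
  by move=> /UP[q Dq qp]; exists (pickle q); [exact: I | rewrite pickleK (mem_set Dq)].
move=> [n _]; case: (unpickle n) => [q|//]; case: ifPn => [/set_mem Dq qp|//].
by apply/UP; exists q.
Qed.

Lemma open_measurable_plane (U : set (R * R)) : open U -> measurable (U : set plane).
Proof.
move=> oU; have [|F F_ ->] := @bigcup_rat_boxP U [set q | rat_box q `<=` U].
  move=> p; split=> [/(open_rat_box oU)[q qp qU]|[q qU /qU//]]; by exists q.
apply: bigcup_measurable => n _; have [->|[q _ ->]] := F_ n; first exact: measurable0.
exact: measurable_rat_box.
Qed.

(** The complement of the support is the union of the null rational boxes, of which there are
    countably many. *)
Lemma measure_support_compl (mu : {measure set plane -> \bar R}) :
  mu.-negligible (~` measure_support mu).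
Proof.
have [|F F_ ->] := @bigcup_rat_boxP (~` measure_support mu) [set q | mu (rat_box q) = 0%E].
  move=> p; split.
    move=> /existsNP[U] /not_implyP[oU] /not_implyP[Up] /negP; rewrite -leNgt => mU.
    have [q qp qU] := open_rat_box oU Up; exists q => //=.
    apply/eqP; rewrite eq_le measure_ge0 andbT (le_trans _ mU) // le_measure ?inE //.
      exact: measurable_rat_box.
    exact: open_measurable_plane.
  move=> [q /= q0 qp] /(_ (rat_box q)); rewrite q0 ltxx => H; suff : false by [].
  apply: H => //; rewrite /rat_box (_ : _ `*` _ =
    fst @^-1` `]ratr q.1.1, ratr q.1.2[%classic `&` snd @^-1` `]ratr q.2.1, ratr q.2.2[%classic) //.
  by apply: openI; apply: open_comp => [? _|]; [exact: cvg_fst|exact: interval_open|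
    exact: cvg_snd|exact: interval_open].
apply: negligible_bigcup => n; have [->|[q /= q0 ->]] := F_ n; first exact: negligible_set0.
by apply/negligibleP => //; exact: measurable_rat_box.
Qed.

Definition disc (r : R) : set (R * R) := [set p | p.1 ^+ 2 + p.2 ^+ 2 <= r ^+ 2].

Lemma measurable_disc r : measurable (disc r : set plane).
Proof.
have mf : measurable_fun setT ((fun p => p.1 ^+ 2 + p.2 ^+ 2) : plane -> measurableTypeR R).
  by apply: measurable_funD; apply: measurable_funX; [exact: measurable_fst|exact: measurable_snd].
rewrite (_ : disc r = setT `&` (fun p => p.1 ^+ 2 + p.2 ^+ 2) @^-1` `]-oo, r ^+ 2]%classic).
  by apply: mf => //; exact: measurable_itv.
by apply/seteqP; split => p; rewrite /disc /= in_itv /=; [|case].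
Qed.

Lemma compact_support_disc (mu : {measure set plane -> \bar R}) :
  compact (measure_support mu) -> \forall r \near +oo, mu (~` disc r) = 0%E.
Proof.
move=> /compact_bounded[M [_ Mb]].
pose B := Num.max M 0 + 1.
have B0 : 0 <= B by rewrite /B addr_ge0 // le_max lexx orbT.
near=> r.
(* The norm on the product is the maximum norm, so the squares of the coordinates sum to at most 2
   B^2, below (2 B)^2. *)
have Br : 2 * B <= r by near: r; apply: nbhs_pinfty_ge; exact: num_real.
apply/negligibleP; first by apply: measurableC; exact: measurable_disc.
apply: negligibleS (measure_support_compl mu) => p; apply: contra_not => ps.
have : `|p| <= B.
  by apply: Mb => //; rewrite (@le_lt_trans _ _ (Num.max M 0)) ?le_max ?lexx // ltrDl.
rewrite prod_normE ge_max !ler_norml => /andP[/andP[? ?] /andP[? ?]].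
have : p.1 ^+ 2 <= B ^+ 2 by rewrite -subr_ge0 subr_sqr mulr_ge0 //; lra.
have : p.2 ^+ 2 <= B ^+ 2 by rewrite -subr_ge0 subr_sqr mulr_ge0 //; lra.
have : (2 * B) ^+ 2 <= r ^+ 2 by rewrite lerXn2r // nnegrE; lra.
rewrite /disc /= exprMn; have := sqr_ge0 B; lra.
Unshelve. all: by end_near. Qed.

End PlaneMeasure.

Lemma measurable_region (R : realType) (theta : nat -> R) (k : nat) (r : R) (i : nat) :
  measurable (region k theta r i : set (measurableTypeR R * measurableTypeR R)).
Proof.
rewrite -[X in measurable X]setCK; apply: measurableC; apply: open_measurable_plane.
by apply: closed_openC; exact: region_closed.
Qed.

(** * Upper semicontinuity of the mass of a region *)

Section Semicontinuity.
Variables (R : realType) (T : topologicalType).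
Local Notation plane := (measurableTypeR R * measurableTypeR R)%type.

(** A chord is affine in [p] with coefficients continuous in the parameter, so on the disc its
    variation splits into three terms of size at most e/3, uniformly in [p]. *)
Lemma chord_near (a b : T -> R) (r e : R) (y : T) : 0 < r -> 0 < e ->
  {for y, continuous a} -> {for y, continuous b} ->
  \forall y' \near y, forall p, disc r p ->
    `|chord (a y) (b y) r p - chord (a y') (b y') r p| <= e.
Proof.
move=> r0 e0 ca cb.
pose c y' := cos ((a y' + b y') / 2); pose s y' := sin ((a y' + b y') / 2).
pose d y' := cos ((b y' - a y') / 2).
have cm : {for y, continuous (fun y' => (a y' + b y') / 2)} by apply: cvgMl; apply: cvgD.
have cd : {for y, continuous (fun y' => (b y' - a y') / 2)} by apply: cvgMl; apply: cvgB.
have cc : {for y, continuous c} by apply: continuous_comp cm _; exact: continuous_cos.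
have cs : {for y, continuous s} by apply: continuous_comp cm _; exact: continuous_sin.
have cd' : {for y, continuous d} by apply: continuous_comp cd _; exact: continuous_cos.
have del0 : 0 < e / (3 * r) by rewrite divr_gt0 // mulr_gt0.
near=> y' => p; rewrite /disc /= => pr.
have hc : `|c y - c y'| <= e / (3 * r) by near: y'; apply: cvgr_dist_le.
have hs : `|s y - s y'| <= e / (3 * r) by near: y'; apply: cvgr_dist_le.
have hd : `|d y - d y'| <= e / (3 * r) by near: y'; apply: cvgr_dist_le.
have p1 : `|p.1| <= r.
  rewrite -(ler_pXn2r (n := 2)) ?nnegrE ?(ltW r0) // real_normK ?num_real //.
  by have := sqr_ge0 p.2; lra.
have p2 : `|p.2| <= r.
  rewrite -(ler_pXn2r (n := 2)) ?nnegrE ?(ltW r0) // real_normK ?num_real //.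
  by have := sqr_ge0 p.1; lra.
have -> : chord (a y) (b y) r p - chord (a y') (b y') r p =
    p.1 * (c y - c y') + p.2 * (s y - s y') + r * (d y' - d y).
  by rewrite /chord /c /s /d; ring.
have rde : r * (e / (3 * r)) = e / 3 by field; rewrite gt_eqF.
have bd (x z : R) : `|x| <= r -> `|z| <= e / (3 * r) -> `|x * z| <= e / 3.
  by move=> xr zd; rewrite -rde normrM ler_pM.
rewrite (le_trans (ler_normD _ _)) // (_ : e = e / 3 + e / 3 + e / 3); last by field.
apply: lerD; last by apply: bd; [rewrite ger0_norm // ltW|rewrite distrC].
by rewrite (le_trans (ler_normD _ _)) // lerD // bd.
Unshelve. all: by end_near. Qed.

(** Relaxing the inequalities by e gives sets [G e] that decrease to the region, so some [F n] still
    has mass below [alpha]. For nearby parameters the region stays inside this [F n] within the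
    disc, which carries all the mass. *)
Lemma region_measure_closed (theta : T -> nat -> R) (k i : nat) (r alpha : R)
    (mu : probability plane R) : 0 < r -> (forall m, continuous (theta^~ m)) ->
  mu (~` disc r) = 0%E ->
  closed [set y | (alpha%:E <= mu (region k (theta y) r i))%E].
Proof.
move=> r0 ctheta mu_disc; rewrite -openC openE => y /= /negP; rewrite -ltNge => muy.
pose G (e : R) : set plane := [set p | (forall m, (k * (i %/ k) <= m <= i)%N ->
  - e <= chord_at k (theta y) r m p) /\ chord_at k (theta y) r i.+1 p <= e].
have mG e : measurable (G e).
  have -> : G e = (\bigcap_(m in [set m | (k * (i %/ k) <= m <= i)%N])
     [set p | `[- e, +oo[%classic (chord_at k (theta y) r m p)]) `&`
     [set p | `]-oo, e]%classic (chord_at k (theta y) r i.+1 p)].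
    apply/seteqP; split => p [pos neg].
      split=> [m mi|]; rewrite /= in_itv /= ?andbT //; exact: pos.
    split=> [m mi|]; last by move: neg; rewrite /= in_itv.
    by have := pos m mi; rewrite /= in_itv /= andbT.
  apply: measurableI; last by apply: measurable_chord_preimage; exact: measurable_itv.
  by apply: bigcap_measurableType => m _; apply: measurable_chord_preimage; exact: measurable_itv.
pose F n := G n.+1%:R^-1.
have FE : \bigcap_n F n = region k (theta y) r i.
  apply/seteqP; split => p.
    move=> pF; split=> [m mi|].
      rewrite -oppr_le0; apply/ler_addgt0Pl => e e0; rewrite addr0.
      have [N _ /(_ N (leqnn N)) Ne] := near_infty_natSinv_lt (PosNum e0).
      have [/(_ m mi) H _] := pF N I; rewrite /= in Ne.
      by rewrite lerNl (le_trans _ H) // lerN2 ltW.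
    apply/ler_addgt0Pl => e e0; rewrite addr0.
    have [N _ /(_ N (leqnn N)) Ne] := near_infty_natSinv_lt (PosNum e0).
    by have [_ H] := pF N I; rewrite (le_trans H) // ltW.
  move=> [pos neg] n _; split=> [m mi|]; last by rewrite (le_trans neg).
  by rewrite (le_trans _ (pos m mi)) // oppr_le0.
have [n Fn] : exists n, (mu (F n) < alpha%:E)%E.
  apply: contrapT => /forallNP H.
  have cvF : mu \o F @ \oo --> mu (\bigcap_n F n).
    apply: nonincreasing_cvg_mu => //.
    - by rewrite (le_lt_trans (probability_le1 _ _)) ?ltry // ; exact: mG.
    - by move=> n; exact: mG.
    - by apply: bigcap_measurableType => n _; exact: mG.
    - move=> m n mn; apply/subsetPset => p [pos neg]; have h : n.+1%:R^-1 <= m.+1%:R^-1 :> R.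
        by rewrite lef_pV2 ?posrE // ler_nat.
      split=> [m' mi|]; last exact: le_trans neg h.
      by rewrite (le_trans _ (pos m' mi)) // lerN2.
  have : (alpha%:E <= lim (mu \o F @ \oo))%E.
    apply: lime_ge; first by apply/cvg_ex; exists (mu (\bigcap_n F n)).
    by apply: nearW => n; rewrite leNgt; apply/negP; exact: H.
  by rewrite (cvg_lim _ cvF) // FE leNgt muy.
have near_m m : \forall y' \near y, forall p, disc r p ->
    `|chord_at k (theta y) r m p - chord_at k (theta y') r m p| <= n.+1%:R^-1.
  by apply: chord_near => //; apply: ctheta.
have {}near_m : \forall y' \near y, forall (m : 'I_i.+2) p, disc r p ->
    `|chord_at k (theta y) r m p - chord_at k (theta y') r m p| <= n.+1%:R^-1.
  apply: filter_forall => m; exact: near_m.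
apply: filterS near_m => y' close; apply/negP; rewrite -ltNge (le_lt_trans _ Fn) //.
have sub : region k (theta y') r i `<=` F n `|` ~` disc r.
  move=> p [pos neg]; have [pd|pd] := pselect (disc r p); [left|by right].
  split=> [m mi|].
    have mi2 : (m < i.+2)%N by lia.
    have := close (Ordinal mi2) p pd; have := pos m mi.
    by rewrite /= ler_norml => hp /andP[h1 _]; rewrite (le_trans h1) // lerBlDr lerDl.
  have := close ord_max p pd; rewrite /= ler_norml => /andP[_ h2].
  by rewrite (le_trans _ h2) // lerDl oppr_ge0.
have mR := measurable_region (theta y') k r i.
have mD : measurable (~` disc r : set plane) by apply: measurableC; exact: measurable_disc.
apply: (@le_trans _ _ (mu (F n `|` ~` disc r))).
  by apply: le_measure; rewrite ?inE //; apply: measurableU => //; exact: mG.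
by rewrite measureU0 //; exact: mG.
Qed.
End Semicontinuity.

(** * Angles parametrized by the cube *)

Section Angles.
Variable R : realType.
Implicit Types f : nat -> R.

Fixpoint running_max f (m : nat) : R :=
  if m is m'.+1 then Num.max (running_max f m') (f m') else 0.

Lemma running_max_ge0 f m : 0 <= running_max f m.
Proof. by elim: m => //= m IHm; rewrite le_max IHm. Qed.

Lemma running_max_le1 f m : (forall i, f i <= 1) -> running_max f m <= 1.
Proof. by move=> f1; elim: m => [|m IHm] /=; rewrite ?ler01 // ge_max IHm f1. Qed.

Lemma running_max_ge f i m : (i < m)%N -> f i <= running_max f m.
Proof.
elim: m => // m IHm; rewrite ltnS leq_eqVlt => /orP[/eqP->|/IHm h] /=.
  by rewrite le_max lexx orbT.
by rewrite le_max h.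
Qed.

(* The arc between [angles n f i] and [angles n f i.+1] is degenerate when     *)
(* [f i = 0], and all arcs after it are degenerate when [f i = 1].             *)
Definition angles (n : nat) f (m : nat) : R :=
  2 * pi * running_max f (m %% n) + 2 * pi * (m %/ n)%:R.

Variable n : nat.
Hypothesis n0 : (0 < n)%N.

Let twopi0 : 0 <= 2 * pi :> R. Proof. by rewrite mulr_ge0 // pi_ge0. Qed.

Lemma angles_turn f m : angles n f (m + n) = angles n f m + 2 * pi.
Proof.
rewrite /angles modnDr (_ : ((m + n) %/ n = (m %/ n).+1)%N); last first.
  by rewrite divnDr ?dvdnn // divnn n0 addn1.
by rewrite -[(m %/ n).+1%:R]natr1 (mulrDr (2 * pi) (m %/ n)%:R 1) mulr1 addrA.
Qed.

Lemma angles_small f m : (m < n)%N -> angles n f m = 2 * pi * running_max f m.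
Proof. by move=> mn; rewrite /angles modn_small // divn_small // mulr0 addr0. Qed.

Lemma angles_n f : angles n f n = 2 * pi.
Proof. by rewrite -[X in angles _ _ X]add0n angles_turn angles_small //= mulr0 add0r. Qed.

Lemma angles_mono f : (forall i, f i <= 1) -> forall m, angles n f m <= angles n f m.+1.
Proof.
move=> f1 m; rewrite (divn_eq m n) addnC; elim: (m %/ n)%N => [|q IHq]; last first.
  by rewrite mulSn addnCA addnC -addSn !angles_turn lerD2r.
rewrite mul0n addn0; set j := (m %% n)%N; have jn : (j < n)%N by rewrite ltn_pmod.
rewrite angles_small //; have [->|jn'] := eqVneq j.+1 n.
  by rewrite angles_n -[leRHS]mulr1 ler_wpM2l // running_max_le1.
by rewrite angles_small ?ler_wpM2l //=; [rewrite le_max lexx|lia].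
Qed.

Lemma angles_eq0 f m : (m.+1 < n)%N -> f m = 0 -> angles n f m = angles n f m.+1.
Proof.
by move=> mn fm; rewrite !angles_small ?(ltnW mn) //= fm max_l // running_max_ge0.
Qed.

Lemma angles_eq1 f i m : (forall i, f i <= 1) -> f i = 1 -> (i < m < n)%N ->
  angles n f m = angles n f m.+1.
Proof.
move=> f1 fi /andP[im mn].
have max1 l : (i < l)%N -> running_max f l = 1.
  by move=> il; apply/le_anti; rewrite running_max_le1 // -fi running_max_ge.
rewrite angles_small // max1 // mulr1; have [->|mn'] := eqVneq m.+1 n.
  by rewrite angles_n.
by rewrite angles_small ?max1 ?mulr1 //; lia.
Qed.

Lemma angles_continuous (T : topologicalType) (f : T -> nat -> R) m :
  (forall i, continuous (f^~ i)) -> continuous (fun y => angles n (f y) m).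
Proof.
move=> cf y; rewrite /angles; apply: cvgD; last exact: cvg_cst.
apply: cvgMr; elim: (m %% n)%N => [|j IHj] /=; first exact: cvg_cst.
exact: (@continuous_max R T (fun y => running_max (f y) j) (f^~ j) y IHj (cf j y)).
Qed.

End Angles.

Lemma turn_strict (R : realType) (n : nat) (theta : nat -> R) : (0 < n)%N ->
  (forall m, theta (m + n)%N = theta m + 2 * pi) ->
  (forall m, (m < n)%N -> theta m < theta m.+1) -> forall m, theta m < theta m.+1.
Proof.
move=> n0 turn lt m; rewrite (divn_eq m n) addnC; elim: (m %/ n)%N => [|q IHq].
  by rewrite mul0n addn0 lt // ltn_pmod.
by rewrite mulSn addnCA addnC -addSn !turn ltrD2r.
Qed.

(** Within the disc the region is contained in two lines, which absolute continuity makes null. *)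
Lemma region_null (R : realType) (k i : nat) (theta : nat -> R) (r : R)
    (mu : probability (measurableTypeR R * measurableTypeR R)%type R) :
  (0 < k)%N -> 0 < r -> (forall m, theta (m + 2 * k)%N = theta m + 2 * pi) ->
  (forall m, theta m <= theta m.+1) -> theta i = theta i.+1 ->
  mu `<< plane_lebesgue R -> mu (~` disc r) = 0%E -> mu (region k theta r i) = 0%E.
Proof.
move=> k0 r0 turn mono e mu_ac mu_disc.
have null m : mu.-negligible [set p | chord_at k theta r m p = 0].
  have mh : measurable ([set p | chord_at k theta r m p = 0] :
      set (measurableTypeR R * measurableTypeR R)).
    exact: (measurable_chord_preimage _ _ _ (measurable_set1 0)).
  apply/negligibleP => //; apply/measure0_null_setP => //; apply: mu_ac.
  by apply/measure0_null_setP => //; exact: plane_lebesgue_chord.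
have nD : mu.-negligible (~` disc r).
  by apply/negligibleP => //; apply: measurableC; exact: measurable_disc.
apply/negligibleP; first exact: measurable_region.
apply: negligibleS (negligibleU nD (negligibleU (null i) (null i.+1))) => p rp.
have [pd|pd] := pselect (disc r p); [right|by left].
exact: (region_degenerate k0 turn r0 mono e pd rp).
Qed.

Theorem theorem4p1 (R : realType) (k : nat) (hk : (1 <= k)%N)
    (mu : 'I_(2 * k) ->
      probability (measurableTypeR R * measurableTypeR R)%type R)
    (mu_ac : forall i, mu i `<< plane_lebesgue R)
    (mu_compact : forall i, compact (measure_support (mu i)))
    (alpha : 'I_(2 * k) -> R)
    (alpha_gt0 : forall i, 0 < alpha i)
    (alpha_sum : \sum_(i < 2 * k) alpha i = 1) :
  exists Q : 'I_(2 * k) -> set (R * R),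
    [/\ convex_partition Q,
        uses_lines k Q,
        counterclockwise_order Q &
        exists pi : {perm 'I_(2 * k)},
          forall i, ((alpha i)%:E <= mu (pi i) (Q i))%E].
Proof.
have [r r0 mu_disc] : exists2 r : R, 0 < r & forall j, mu j (~` disc r) = 0%E.
  have rnear : \forall r \near +oo, 0 < r /\ forall j, mu j (~` disc r) = 0%E.
    near=> r; split; first by near: r; apply: nbhs_pinfty_gt; exact: num_real.
    near: r; apply: filter_forall => j; exact: compact_support_disc.
  by have [r []] := filter_ex rnear; exists r.
have n0 : (0 < 2 * k)%N by rewrite muln_gt0.
have [d nd] : exists d, (2 * k)%N = d.+2 by exists (2 * k).-2; lia.
(* The running maxima read only the indices 0 to d, so [inord] never falls back on its default. *)
pose theta (y : 'rV[R]_d.+1) := angles (2 * k) (fun m => y ord0 (inord m)).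
pose A (i j : 'I_(2 * k)) := [set y | ((alpha i)%:E <= mu j (region k (theta y) r i))%E].
have turn (y : 'rV[R]_d.+1) := @angles_turn R _ n0 (fun m => y ord0 (inord m)).
have null (y : 'rV[R]_d.+1) (i j : 'I_(2 * k)) :
    unit_cube y -> theta y i = theta y i.+1 -> ~ A i j y.
  move=> cy e; rewrite /A /= (region_null hk r0 (turn y) _ e) // => [|m].
    by rewrite lee_fin leNgt alpha_gt0.
  by apply: angles_mono => // i'; have /andP[] := cy (inord i').
have [||||y [sigma [cy yA]]] := @colorful_kkm R d _ A nd.
- move=> i j; apply: region_measure_closed => // m; apply: angles_continuous => l.
  exact: coord_continuous.
(* Covering: if every region had mass below its threshold, the total mass would be less than 1. *)
- move=> j y cy; apply: contrapT => /forallNP H.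
  pose Q := region k (theta y) r.
  have mQ i : measurable (Q i : set (measurableTypeR R * measurableTypeR R)).
    exact: measurable_region.
  have : (mu j (\big[setU/set0]_(i < 2 * k) Q i) <= \sum_(i < 2 * k) mu j (Q i))%E.
    by apply: Boole_inequality => i _.
  have -> : \big[setU/set0]_(i < 2 * k) Q i = setT.
    rewrite -bigcup_mkord; apply/seteqP; split => // p _.
    by have [i ik ip] := region_cover r hk (turn y) p; exists i.
  rewrite probability_setT => le1.
  have muQ (i : 'I_(2 * k)) : mu j (Q i) = (fine (mu j (Q i)))%:E.
    by rewrite fineK // fin_num_measure.
  have : \sum_(i < 2 * k) fine (mu j (Q i)) < \sum_(i < 2 * k) alpha i.
    apply: ltr_sum => [|i _]; last first.
      by rewrite -lte_fin -muQ ltNge; apply/negP; exact: H.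
    by apply/hasP; exists (Ordinal n0); rewrite // mem_index_enum.
  rewrite alpha_sum ltNge => /negP; apply; rewrite -lee_fin -sumEFin.
  by rewrite (le_trans le1) //; apply: lee_sum => i _; rewrite -muQ.
(* A zero coordinate collapses the arc of the same index, and a null region cannot reach a positive
   threshold. *)
- move=> i l j y cy yi yA; apply/eqP => li; apply: null yA => //; rewrite li.
  apply: angles_eq0 => //; first by have := ltn_ord i; lia.
  by rewrite inord_val.
(* A coordinate equal to 1 completes the turn, so all later arcs collapse. *)
- move=> i l j y cy yi yA; rewrite leqNgt; apply/negP => il; apply: null yA => //.
  apply: (@angles_eq1 _ _ n0 _ i) => [i'||]; first by have /andP[] := cy (inord i').
    by rewrite inord_val.
  by rewrite il ltn_ord.
(* Only at the solution are the angles known to be strictly increasing: every threshold is positive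
   and met, so no arc is degenerate. *)
have strict : forall m, theta y m < theta y m.+1.
  apply: (turn_strict n0 (turn y)) => m mn; rewrite lt_neqAle.
  rewrite angles_mono // => [|i']; last by have /andP[] := cy (inord i').
  rewrite andbT; apply/eqP => /(null y (Ordinal mn) (sigma (Ordinal mn)) cy).
  by apply; exact: yA.
have [part lines ccw] := regions_partition hk (turn y) r0 strict.
exists (fun i => region k (theta y) r i); split => //.
by exists sigma; exact: yA.
Unshelve. all: by end_near. Qed.
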